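(* Let $q$ be a prime power, let $F=\mathbb{F}_q$, let $m(x)=x^3+ax^2+bx+c\in F[x]$ be irreducible, and let $S\subseteq \mathcal{C}(m)$. If $|S|\geq q^3-q^2+1$, then $S$ is core.
   Context: $M_3(F)$ is the ring of $3\times 3$ matrices over the field $F$. $\mathcal{C}(m)$ is the set of all $A\in M_3(F)$ whose minimal polynomial is $m$. For polynomials in $M_3(F)[x]$ the indeterminate $x$ is central (commutes with all coefficients), and $f(x)=\sum_i \alpha_i x^i$ is evaluated at $A\in M_3(F)$ by right evaluation, $f(A)=\sum_i \alpha_i A^i$. For $S\subseteq M_3(F)$, the null ideal of $S$ is $N(S)=\{f\in M_3(F)[x] : f(A)=0 \text{ for all } A\in S\}$. The set $S$ is called core if $N(S)$ is a two-sided ideal of $M_3(F)[x]$. *)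

(* Defs.v *)
From HB Require Import structures.
From mathcomp Require Import all_boot all_order all_algebra.

Set Implicit Arguments.
Unset Strict Implicit.
Unset Printing Implicit Defensive.

Import GRing.Theory.
Local Open Scope ring_scope.

Definition minpoly_class (F : finFieldType) (m : {poly F}) : {set 'M[F]_3} :=
  [set A | mxminpoly A == m].

(* In {poly R} with R noncommutative, 'X is central and, by horner_coef,
   f.[A] = \sum_i f`_i * A ^+ i: coefficients stay on the left, i.e., this is
   right evaluation. *)
Definition null_ideal (F : finFieldType) (S : {set 'M[F]_3})
    : {pred {poly 'M[F]_3}} :=
  [pred f : {poly 'M[F]_3} | [forall A in S, f.[A] == 0]].

(* The ideals of ring_quotient.v are one-sided and required to be proper;
   neither is wanted here. *)
Definition two_sided_ideal (R : nzRingType) (I : {pred R}) : Prop :=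
  [/\ zmod_closed I,
      forall r, {in I, forall f, r * f \in I} &
      forall r, {in I, forall f, f * r \in I}].

Definition core (F : finFieldType) (S : {set 'M[F]_3}) : Prop :=
  two_sided_ideal (null_ideal S).

(* Main.v *)
Require Import Defs.
From HB Require Import structures.
From mathcomp Require Import all_boot all_order all_algebra.
From mathcomp Require Import qpoly ring.

(* Dividing f in N(S) by the central polynomial m leaves a remainder of degree
   at most 2; S is core as soon as this remainder is always zero.  A nonzero row
   of a nonzero remainder gives polynomials k_j, one of them invertible modulo m,
   with sum_j e_j k_j(A) = 0 for all A in S, and one can scale to
   e_i + e_j l1(A) + e_k l2(A) = 0.  Fix A0 in S.  Each A in S is P A0 P^-1 for a
   unique P fixing e_j, because F[A0] is a cubic field acting on F^3.  The
   relation shows that y = e_k P determines P, hence A; and y avoids the set of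
   those y for which e_j, y, e_j l1(A0) + y l2(A0) are linearly dependent.  This
   set has at least q^2 elements, so that |S| <= q^3 - q^2. *)

Set Implicit Arguments.
Unset Strict Implicit.
Unset Printing Implicit Defensive.

Import GRing.Theory.
Local Open Scope ring_scope.

(** * Counting degenerate vectors *)

(** The second alternative means having no eigenvalue in [F]. Elements of a field [F[A]] satisfy
    this dichotomy, the only property of [L1] and [L2] used in the count. *)
Definition scalar_or_regular (F : finFieldType) n (L : 'M[F]_n) :=
  is_scalar_mx L || [forall s, L - s%:M \in unitmx].

(* Equivalently, e, y and e L1 + y L2 are linearly dependent (for e nonzero). *)
Definition degenerate (F : finFieldType) n (e : 'rV[F]_n) (L1 L2 : 'M[F]_n) :=
  [set y | [exists t, y == t *: e] ||
           [exists s, exists t, e *m L1 + y *m L2 == s *: y + t *: e]].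

(** Otherwise [e] would be an eigenvector of [L] with eigenvalue [s^-1 * t]. *)
Lemma regular_row_eq0 (F : finFieldType) n (L : 'M[F]_n) (e : 'rV[F]_n) s t :
  [forall s, L - s%:M \in unitmx] -> s *: (e *m L) = t *: e -> e != 0 -> s = 0.
Proof.
move=> /forallP regL sLte; apply: contra_neq_eq => s0.
have eL0 : e *m (L - (s^-1 * t)%:M) = 0.
  by rewrite mulmxBr mul_mx_scalar -scalerA -sLte scalerA mulVf // scale1r subrr.
by rewrite -[e](mulmxK (regL (s^-1 * t))) eL0 mul0mx.
Qed.

(** [F * F] injects into the degenerate set: as a plane through [e] if [L2] is scalar, and otherwise
    by solving for [y] with given coefficients [s], [t]. *)
Lemma card_degenerate (F : finFieldType) n (e : 'rV[F]_n) (L0 L1 L2 : 'M[F]_n) :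
  e != 0 -> [forall s, L0 - s%:M \in unitmx] ->
  scalar_or_regular L1 -> scalar_or_regular L2 ->
  (#|F| ^ 2 <= #|degenerate e L1 L2|)%N.
Proof.
move=> e0 regL0 L1P L2P.
have scaleIe s t : s *: e = t *: e -> s = t.
  by move/eqP; rewrite -subr_eq0 -scalerBl scaler_eq0 (negPf e0) orbF subr_eq0
    => /eqP.
suff [g [g_inj gP]] : exists g : F * F -> 'rV[F]_n,
    injective g /\ forall st, g st \in degenerate e L1 L2.
  rewrite -mulnn -card_prod -(card_imset predT g_inj).
  by apply/subset_leq_card/subsetP => _ /imsetP[st _ ->].
case/orP: L2P => [/is_scalar_mxP[s2 ->] | regL2].
  (* The plane will be spanned by [e] and [e L]. If [L1] is scalar too, [L0] supplies the second
     direction. *)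
  have [L [regL eL]] : exists L, [forall s, L - s%:M \in unitmx] /\
      exists u v, e *m L1 = u *: (e *m L) + v *: e.
    case/orP: L1P => [/is_scalar_mxP[s1 ->] | regL1].
      by exists L0; split=> //; exists 0, s1; rewrite scale0r add0r mul_mx_scalar.
    by exists L1; split=> //; exists 1, 0; rewrite scale0r addr0 scale1r.
  exists (fun st => st.1 *: e + st.2 *: (e *m L)); split=> [[s t] [s' t'] /=|].
    move/eqP; rewrite -subr_eq0 opprD addrACA -!scalerBl addrC addr_eq0 -scaleNr.
    move=> /eqP E; have /eqP := regular_row_eq0 regL E e0.
    rewrite subr_eq0 => /eqP tt; move: E; rewrite tt subrr scale0r => /esym/eqP.
    by rewrite scaler_eq0 (negPf e0) orbF oppr_eq0 subr_eq0 => /eqP->.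
  move=> [s t] /=; rewrite inE; have [->|t0] := eqVneq t 0.
    by apply/orP; left; apply/existsP; exists s; rewrite scale0r addr0.
  have [u [v ->]] := eL; apply/orP; right.
  (* With [w = e L] and [y = s e + t w], substitute [w = (y - s e) / t] into [u w + v e + s2 y]. *)
  apply/existsP; exists (u / t + s2); apply/existsP; exists (v - u / t * s).
  move: (e *m L) => w; apply/eqP/rowP=> i.
  by rewrite mul_mx_scalar !mxE; field.
(* f (s, t) is the solution y of e L1 + y L2 = s y + t e.  It determines (s, t)
   unless it is a multiple of e; those values are replaced by s e. *)
have regL2' := forallP regL2.
pose f (st : F * F) := e *m (st.2%:M - L1) *m invmx (L2 - st.1%:M).
have fP st : f st *m (L2 - st.1%:M) = e *m (st.2%:M - L1).
  by rewrite /f mulmxKV.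
pose g st := if [exists t, f st == t *: e] then st.1 *: e else f st.
exists g; split=> [[s t] [s' t']|st].
  rewrite /g; case: existsP => [[r /eqP fr]|fN];
    case: existsP => [[r' /eqP fr']|fN'] //=.
  - move=> /scaleIe ss; subst s'; move: (fP (s, t)) (fP (s, t')) => /=.
    rewrite fr fr' !mulmxBr !mul_mx_scalar -!scalemxAl => E E'.
    (* Subtracting the two equations; regularity of [L2] then forces [r = r'], hence [t = t']. *)
    have /eqP : (r - r') *: (e *m L2) = ((r - r') * s + t - t') *: e.
      move: E E'; move: (e *m L1) (e *m L2) => w1 w2 /rowP E /rowP E'.
      apply/rowP=> i; move: (E i) (E' i); rewrite !mxE => Ei E'i.
      have -> : (r - r') * w2 0 i = r * w2 0 i - s * (r * e 0 i)
        - (r' * w2 0 i - s * (r' * e 0 i)) + (r - r') * s * e 0 i by ring.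
      by rewrite Ei E'i; ring.
    move=> /eqP /[dup] /regular_row_eq0 -> //; rewrite scale0r mul0r add0r.
    move=> /esym/eqP; rewrite scaler_eq0 (negPf e0) orbF subr_eq0.
    by move=> /eqP->.
  - by move=> E; case: fN'; exists s; apply/eqP.
  - by move=> E; case: fN; exists s'; apply/eqP.
  move=> ff'; move: (fP (s, t)) (fP (s', t')) => /=; rewrite -ff'.
  move: fN; move: (f (s, t)) => y yN; rewrite !mulmxBr !mul_mx_scalar => E E'.
  (* Since [y] is not a multiple of [e], both coefficients must vanish. *)
  have E2 : (s' - s) *: y = (t - t') *: e.
    move: E E'; move: (e *m L1) (y *m L2) => w1 w2 /rowP E /rowP E'.
    apply/rowP=> i; move: (E i) (E' i); rewrite !mxE => Ei E'i.
    have -> : (s' - s) * y 0 i = w2 0 i - s * y 0 i - (w2 0 i - s' * y 0 i).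
      by ring.
    by rewrite Ei E'i; ring.
  have [ss | ss] := eqVneq (s' - s) 0; last first.
    case: yN; exists ((s' - s)^-1 * (t - t')).
    by rewrite -scalerA -E2 scalerA mulVf // scale1r.
  move: E2; rewrite ss scale0r => /esym/eqP.
  rewrite scaler_eq0 (negPf e0) orbF subr_eq0 => /eqP->.
  by move/eqP: ss; rewrite subr_eq0 => /eqP->.
rewrite inE /g; case: ifP => [_|_].
  by apply/orP; left; apply/existsP; exists st.1.
apply/orP; right; apply/existsP; exists st.1; apply/existsP; exists st.2.
move: (fP st); rewrite !mulmxBr !mul_mx_scalar => /(canRL (subrK _)) ->.
by apply/eqP; rewrite addrA addrC subrKC addrC.
Qed.

(** * The field [F[A]] and its action on row vectors *)

Lemma horner_mx_unit (F : fieldType) n (A : 'M[F]_n.+1) (p : {poly F}) :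
  irreducible_poly (mxminpoly A) -> horner_mx A p != 0 ->
  horner_mx A p \in unitmx.
Proof.
move=> irrA pA0; have : coprimep (mxminpoly A) p.
  by rewrite irreducible_poly_coprime //; apply: contraNN pA0 => /mxminpoly_minP->.
case/Bezout_eq1_coprimepP=> -[u v] /= /(congr1 (horner_mx A)).
rewrite rmorphD !rmorphM rmorph1 /= mx_root_minpoly mulr0 add0r.
by case/mulmx1_unit.
Qed.

Lemma horner_scalar_or_regular (F : finFieldType) n (A : 'M[F]_n.+1) p :
  irreducible_poly (mxminpoly A) -> scalar_or_regular (horner_mx A p).
Proof.
move=> irrA; apply/orP; case: (boolP (is_scalar_mx _)) => [|pN]; [by left|right].
apply/forallP=> s; rewrite -(horner_mx_C A) -rmorphB horner_mx_unit //.
rewrite rmorphB /= horner_mx_C subr_eq0; apply: contraNneq pN => ->.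
exact: scalar_mx_is_scalar.
Qed.

Definition krylov (F : fieldType) n (A : 'M[F]_n.+1) (v : 'rV[F]_n.+1) :=
  \matrix_(i < n.+1) (v *m A ^+ i).

Lemma mul_krylov (F : fieldType) n (A : 'M[F]_n.+1) v x :
  x *m krylov A v = v *m horner_mx A (rVpoly x).
Proof.
rewrite mulmx_sum_row [rVpoly x]poly_def linear_sum mulmx_sumr.
apply: eq_bigr => i _.
by rewrite rowK valK linearZ /= -scalemxAr rmorphXn /= horner_mx_X.
Qed.

Lemma delta_mul_krylov (F : fieldType) n (A : 'M[F]_n.+1) v :
  delta_mx 0 0 *m krylov A v = v.
Proof. by rewrite -rowE rowK mulmx1. Qed.

(** A linear dependence among the rows reads [v p(A) = 0] with [p] of degree at most [n]. As [F[A]]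
    is a field, [p(A) = 0], and the degree of the minimal polynomial gives [p = 0]. *)
Lemma krylov_unit (F : fieldType) n (A : 'M[F]_n.+1) v :
  irreducible_poly (mxminpoly A) -> size (mxminpoly A) = n.+2 -> v != 0 ->
  krylov A v \in unitmx.
Proof.
move=> irrA szA v0; rewrite -row_free_unit; apply/inj_row_free => x.
rewrite mul_krylov => vx0; have [xA0|/(horner_mx_unit irrA) xAu] :=
    eqVneq (horner_mx A (rVpoly x)) 0; last first.
  by case/eqP: v0; rewrite -[v](mulmxK xAu) vx0 mul0mx.
apply: (can_inj rVpolyK); rewrite linear0; apply/eqP.
apply: contraTT (mxminpoly_min xA0) => /dvdp_leq lex.
apply/negP=> /lex; rewrite szA leqNgt ltnS => /negP[].
exact: size_poly.
Qed.

(** [C] is the companion matrix of [m]; what matters is that it depends neither on [A] nor on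
    [v]. *)
Lemma krylov_mul (F : fieldType) n (m : {poly F}) : size m = n.+2 ->
  exists C : 'M[F]_n.+1, forall (A : 'M[F]_n.+1) v, mxminpoly A = m ->
    krylov A v *m A = C *m krylov A v.
Proof.
move=> szm; exists (\matrix_(i < n.+1) poly_rV ('X^(i.+1) %% m)) => A v Am.
apply/row_matrixP=> i; rewrite !row_mul !rowK mul_krylov poly_rV_K; last first.
  by rewrite -ltnS -szm ltn_modp -size_poly_eq0 szm.
have -> : horner_mx A ('X^(i.+1) %% m) = horner_mx A 'X^(i.+1).
  rewrite [in RHS](divp_eq 'X^(i.+1) m) rmorphD rmorphM /= -Am mx_root_minpoly.
  by rewrite mulr0 add0r.
by rewrite rmorphXn /= horner_mx_X exprSr mulmxA.
Qed.

(** Both matrices become the same companion matrix in their Krylov bases, and both bases begin with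
    [v]. *)
Lemma krylov_conj (F : fieldType) n (A B : 'M[F]_n.+1) v :
  irreducible_poly (mxminpoly A) -> size (mxminpoly A) = n.+2 ->
  mxminpoly B = mxminpoly A -> v != 0 ->
  let P := invmx (krylov A v) *m krylov B v in
  [/\ P \in unitmx, v *m P = v & A *m P = P *m B].
Proof.
move=> irrA szA BA v0 P; have [C CP] := krylov_mul szA.
have uA : krylov A v \in unitmx by exact: krylov_unit.
have uB : krylov B v \in unitmx by apply: krylov_unit; rewrite ?BA.
split; first by rewrite unitmx_mul unitmx_inv uA uB.
  by rewrite mulmxA -{1}(delta_mul_krylov A v) mulmxK // delta_mul_krylov.
rewrite -[A](mulKmx uA) CP // /P !mulmxA mulmxK // -!mulmxA CP //.
Qed.

Lemma conj_horner_mx (F : fieldType) n (A B P : 'M[F]_n.+1) p :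
  A *m P = P *m B -> horner_mx A p *m P = P *m horner_mx B p.
Proof.
move=> AP; elim/poly_ind: p => [|p c IHp]; first by rewrite !rmorph0 mul0mx mulmx0.
rewrite !rmorphD !rmorphM /= !horner_mx_X !horner_mx_C mulmxDl mulmxDr.
by rewrite scalar_mxC -mulmxA AP !mulmxA IHp.
Qed.

(** * Bounding a set annihilated by a row relation *)

Lemma sum_ord3_shift (V : nmodType) (i : 'I_3) (f : 'I_3 -> V) :
  \sum_x f x = f i + f (i + 1) + f (i + 2%:R).
Proof.
rewrite (reindex_inj (addrI i)) !big_ord_recr big_ord0 /= add0r.
by congr (f _ + f _ + f _); apply: val_inj; case: i => [[|[|[|]]]].
Qed.

(** Addition in ['I_3] is modulo 3, so the index of the invertible [k i] can stay arbitrary. *)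
Lemma ord3_shiftP (i x : 'I_3) : [\/ x = i, x = i + 1 | x = i + 2%:R].
Proof.
by case: i => [[|[|[|]]] ?] //; case: x => [[|[|[|]]] ?] //;
  (constructor 1 + constructor 2 + constructor 3); apply: val_inj.
Qed.

Lemma card_row_annihilated (F : finFieldType) (m : {poly F})
    (S : {set 'M[F]_3}) (k : 'I_3 -> {poly F}) i :
  irreducible_poly m -> size m = 4%N -> S \subset minpoly_class m ->
  ~~ (m %| k i) ->
  {in S, forall A, \sum_j row j (horner_mx A (k j)) = 0} ->
  (#|S| <= #|F| ^ 3 - #|F| ^ 2)%N.
Proof.
move=> irrm szm /subsetP Sm mki Sk.
have [->|[A0 A0S]] := set_0Vmem S; first by rewrite cards0.
have minm A : A \in S -> mxminpoly A = m by move=> /Sm; rewrite inE => /eqP.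
have A0m := minm _ A0S.
have irrA0 : irreducible_poly (mxminpoly A0) by rewrite A0m.
have /Bezout_eq1_coprimepP[[u v] /= uv1] : coprimep m (k i).
  by rewrite irreducible_poly_coprime.
pose e x : 'rV[F]_3 := delta_mx 0 x.
have e0 x : e x != 0 by apply/eqP => /rowP/(_ x)/eqP; rewrite !mxE !eqxx oner_eq0.
(* [v] inverts [k i] modulo [m]; multiplying the relation by [v(A)] makes the coefficient of [e i]
   equal to 1. *)
pose l1 := k (i + 1) * v; pose l2 := k (i + 2%:R) * v.
have Sl A : A \in S -> e i + e (i + 1) *m horner_mx A l1
                           + e (i + 2%:R) *m horner_mx A l2 = 0.
  move=> AS; have /(congr1 (mulmx^~ (horner_mx A v))) := Sk A AS.
  rewrite (sum_ord3_shift i) mul0mx !mulmxDl !rowE -!mulmxA => <-.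
  congr (_ + _ + _); rewrite /l1 /l2 ?rmorphM //.
  have /(congr1 (horner_mx A)) := uv1.
  rewrite rmorphD !rmorphM rmorph1 /= -(minm A AS) mx_root_minpoly mulr0 add0r.
  by move=> vk; rewrite [horner_mx A (k i) *m _](comm_horner_mx2 A _ v) vk mulmx1.
have [P PP] : exists P, forall A, A \in S ->
    [/\ P A \in unitmx, e (i + 1) *m P A = e (i + 1) & A *m P A = P A *m A0].
  exists (fun A => invmx (krylov A (e (i + 1))) *m krylov A0 (e (i + 1))).
  by move=> A AS; apply: krylov_conj; rewrite ?minm.
pose y A := e (i + 2%:R) *m P A.
have eiP A : A \in S -> e i *m P A =
    - (e (i + 1) *m horner_mx A0 l1 + y A *m horner_mx A0 l2).
  move=> AS; have [_ vP AP] := PP A AS.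
  apply/eqP; rewrite -addr_eq0 addrA; apply/eqP.
  have /(congr1 (mulmx^~ (P A))) := Sl A AS.
  by rewrite mul0mx !mulmxDl -!mulmxA !(conj_horner_mx _ AP) !mulmxA vP.
(* The rows of [P A] are the fixed [e (i + 1)], [y A], and a function of [y A] by [eiP]. *)
have y_inj : {in S &, injective y}.
  move=> A B AS BS yAB; have [uA vA AP] := PP A AS; have [uB vB BP] := PP B BS.
  suff PAB : P A = P B by rewrite -[A](mulmxK uA) AP PAB -BP mulmxK.
  apply/row_matrixP=> x; rewrite !rowE.
  by case: (ord3_shiftP i x) => ->; rewrite -!/(e _) ?eiP ?vA ?vB ?yAB.
set D := degenerate (e (i + 1)) (horner_mx A0 l1) (horner_mx A0 l2).
(* Degeneracy of [y A] would be a linear dependence among the rows of the invertible [P A]. *)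
have yD A : A \in S -> y A \notin D.
  move=> AS; have [uA vA _] := PP A AS; rewrite inE.
  apply/norP; split; apply/existsP=> -[s].
    rewrite /y -vA scalemxAl => /eqP/(can_inj (mulmxK uA)) /rowP/(_ (i + 2%:R)).
    rewrite !mxE !eqxx (inj_eq (addrI i)) /= mulr0 => /eqP.
    by rewrite oner_eq0.
  move=> /existsP[t] /eqP; rewrite -[LHS]opprK -eiP //.
  rewrite -vA /y !scalemxAl -mulmxDl -mulNmx => /(can_inj (mulmxK uA)) /rowP/(_ i).
  have iD x : (i == i + x) = (x == 0).
    by rewrite -{1}[i]addr0 (inj_eq (addrI i)) eq_sym.
  rewrite !mxE !eqxx !iD /= !mulr0 addr0 => /eqP.
  by rewrite oppr_eq0 oner_eq0.
have cardD : (#|F| ^ 2 <= #|D|)%N.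
  apply: (card_degenerate (L0 := A0)); rewrite ?e0 //.
  - apply/forallP=> s; have := horner_mx_unit (A := A0) (p := 'X - s%:P) irrA0.
    rewrite rmorphB /= horner_mx_X horner_mx_C; apply.
    rewrite -[A0 in A0 - _]horner_mx_X -(horner_mx_C A0) -rmorphB.
    apply/negP=> /eqP/mxminpoly_min/dvdp_leq.
    by rewrite polyXsubC_eq0 size_XsubC A0m szm => /(_ isT).
  - exact: horner_scalar_or_regular.
  - exact: horner_scalar_or_regular.
rewrite -(card_in_imset y_inj).
have : y @: S \subset ~: D.
  by apply/subsetP=> _ /imsetP[A AS ->]; rewrite inE yD.
move/subset_leq_card/leq_trans; apply.
have := cardsC D; rewrite card_mx mul1n => <-.
by rewrite leq_subRL ?leq_add2r ?(leq_trans cardD) ?leq_addr.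
Qed.

(** * The null ideal and division by [m] *)

Lemma map_poly_scalar_mxC (F : fieldType) n (m : {poly F}) (r : {poly 'M[F]_n.+1}) :
  map_poly scalar_mx m * r = r * map_poly scalar_mx m.
Proof.
apply/polyP=> i; rewrite coefM coefMr; apply: eq_bigr => j _.
by rewrite coef_map /= -[_ * _]scalar_mxC.
Qed.

(** Right evaluation at [A] is multiplicative on [r * f] because [f(A) = 0] commutes with [A]. *)
Lemma null_ideal_mull (F : finFieldType) (S : {set 'M[F]_3}) r f :
  f \in null_ideal S -> r * f \in null_ideal S.
Proof.
rewrite !inE => /forall_inP fS; apply/forall_inP=> A /fS/eqP fA.
by rewrite hornerM_comm /comm_poly fA ?mulr0 ?mul0r.
Qed.

Lemma null_ideal_zmod (F : finFieldType) (S : {set 'M[F]_3}) :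
  zmod_closed (null_ideal S).
Proof.
split=> [|f g]; rewrite !inE; first by apply/forall_inP=> A _; rewrite horner0.
move=> /forall_inP fS /forall_inP gS; apply/forall_inP=> A AS.
by rewrite hornerD hornerN (eqP (fS A AS)) (eqP (gS A AS)) subr0.
Qed.

Theorem theorem1p4 (q : nat) (F : finFieldType) (hq : #|F| = q)
    (a b c : F) (m : {poly F})
    (hm : m = 'X^3 + a *: 'X^2 + b *: 'X + c%:P)
    (m_irr : irreducible_poly m)
    (S : {set 'M[F]_3}) (hS : S \subset minpoly_class m)
    (hcard : (q ^ 3 - q ^ 2 + 1 <= #|S|)%N) :
  core S.
Proof.
have szm' : (size (a *: 'X^2 + b *: 'X + c%:P)%R < 4)%N.
  rewrite ltnS; apply/leq_sizeP=> j j3; rewrite !coefE.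
  by case: j j3 => [|[|[|j]]] // _; rewrite !mulr0 !addr0.
have mE : m = 'X^3 + (a *: 'X^2 + b *: 'X + c%:P) by rewrite hm !addrA.
have szm : size m = 4%N by rewrite mE size_polyDl ?size_polyXn.
have monm : m \is monic by rewrite monicE mE lead_coefDl ?size_polyXn ?lead_coefXn.
pose M : {poly 'M[F]_3} := map_poly scalar_mx m.
have monM : M \is monic by rewrite map_monic.
have szM : size M = 4%N by rewrite size_map_poly.
have MS : M \in null_ideal S.
  rewrite inE; apply/forall_inP=> A /(subsetP hS); rewrite inE => /eqP Am.
  by rewrite -[M.[A]]/(horner_mx A m) -Am mx_root_minpoly.
have remS f : f \in null_ideal S -> f = Pdiv.Ring.rdivp f M * M.
  move=> fS; rewrite {1}(Pdiv.RingMonic.rdivp_eq monM f).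
  set h := Pdiv.Ring.rdivp f M; set r := Pdiv.Ring.rmodp f M.
  have rS : r \in null_ideal S.
    have [_ closB] := null_ideal_zmod S.
    have -> : r = f - h * M.
      by rewrite [in f - _](Pdiv.RingMonic.rdivp_eq monM f) addrC addKr.
    exact/closB/null_ideal_mull.
  have szr : (size r <= 3)%N by rewrite -ltnS -szM Pdiv.Ring.ltn_rmodp monic_neq0.
  suff -> : r = 0 by rewrite addr0.
  apply/polyP=> s; rewrite coef0; case: (ltnP s 3) => [s3|]; last first.
    by move=> s3; rewrite nth_default ?(leq_trans szr).
  apply/matrixP=> x i; rewrite [RHS]mxE; apply: contraTeq hcard => rsxi.
  (* Row [x] of [r(A)] is the sum over [j] of row [j] of [k_j(A)], where [k_j] collects the entries
     [(x, j)] of the coefficients of [r]. *)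
  pose k j : {poly F} := \poly_(s < 3) (r`_s x j).
  rewrite -ltnNge addn1 ltnS -hq.
  apply: (card_row_annihilated (k := k) (i := i) m_irr szm hS).
    apply/negP=> /dvdp_leq; rewrite szm leqNgt ltnS size_poly => H.
    have /H // : k i != 0.
    apply: contraNneq rsxi => /polyP/(_ s); rewrite coef_poly s3 coef0.
    by move=> ->.
  move=> A AS; move: rS; rewrite inE => /forall_inP/(_ A AS)/eqP.
  rewrite (horner_coef_wide _ szr) => /(congr1 (row x)).
  rewrite row0 => rA0; rewrite -[RHS]rA0.
  rewrite linear_sum /=.
  under [RHS]eq_bigr => t _ do rewrite row_mul mulmx_sum_row.
  rewrite exchange_big; apply: eq_bigr => j _ /=.
  rewrite /k poly_def !linear_sum; apply: eq_bigr => t _.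
  by rewrite !linearZ /= rmorphXn /= horner_mx_X mxE.
split; [exact: null_ideal_zmod | by move=> r f; apply: null_ideal_mull |].
(* [M] is central, so the right factor [r] moves past it and leaves a left multiple of [M]. *)
move=> r f /remS ->.
by rewrite -mulrA map_poly_scalar_mxC mulrA null_ideal_mull.
Qed.
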